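(* Let $F$ be a field, let $m>1$ be an integer, and let $b,c\in F$. The polynomial $h(x)=x^{2m}+bx^m+c\in F[x]$ is reducible over $F$ if and only if at least one of the following holds: (1) $f(x)=x^2+bx+c$ is reducible over $F$; or (2) for some prime divisor $p$ of $m$ there exist $n,t\in F$ with $c=n^p$ and $b=-D_p(t,n)$; or (3) $4\mid m$ and there exist $n,t\in F$ with $c=16n^4$ and $b=4D_4(t,n)$.
   Context: The Dickson polynomials of the first kind $D_k(t,n)$ are defined by $D_1(t,n)=t$, $D_2(t,n)=t^2-2n$, and $D_k(t,n)=tD_{k-1}(t,n)-nD_{k-2}(t,n)$ for $k>2$; equivalently $D_k(t,n)=\sum_{i=0}^{\lfloor k/2\rfloor}\frac{k}{k-i}\binom{k-i}{i}(-n)^i t^{k-2i}$. For example $D_4(t,n)=t^4-4nt^2+2n^2$. *)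

(* Defs.v *)
From HB Require Import structures.
From mathcomp Require Import all_boot all_order all_algebra.
From mathcomp Require Import ring.

Set Implicit Arguments.
Unset Strict Implicit.
Unset Printing Implicit Defensive.

Import GRing.Theory.
Local Open Scope ring_scope.

(* The value at (t, n) of the Dickson polynomial D_k of the first kind. The
   convention D_0 = 2 extends the recursion downwards, so that it also yields
   D_2 = t ^+ 2 - 2 n (see dickson2). *)
Fixpoint dickson (R : comNzRingType) (k : nat) (t n : R) : R :=
  match k with
  | 0 => 2
  | k'.+1 => match k' with
             | 0 => t
             | k''.+1 => t * dickson k' t n - n * dickson k'' t n
             end
  end.

Lemma dickson1 (R : comNzRingType) (t n : R) : dickson 1 t n = t.
Proof. by []. Qed.

Lemma dickson2 (R : comNzRingType) (t n : R) :
  dickson 2 t n = t ^+ 2 - 2 * n.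
Proof. by rewrite /=; ring. Qed.

Lemma dicksonSS (R : comNzRingType) (k : nat) (t n : R) :
  dickson k.+2 t n = t * dickson k.+1 t n - n * dickson k t n.
Proof. by []. Qed.

Lemma dickson4 (R : comNzRingType) (t n : R) :
  dickson 4 t n = t ^+ 4 - 4 * n * t ^+ 2 + 2 * n ^+ 2.
Proof. by rewrite /=; ring. Qed.

(* Intended for nonconstant p: a constant would also satisfy this predicate. *)
Definition reducible_poly (F : fieldType) (p : {poly F}) : Prop :=
  ~ irreducible_poly p.

(* Main.v *)
(** If f is irreducible, let z be a root of f and K = F(z). By Capelli's lemma,
    f(X^m) is irreducible over F as soon as X^m - z is irreducible over K, and
    by the Vahlen-Capelli criterion the latter holds unless z = y^p with p a
    prime divisor of m, or 4 | m and z = -4 y^4, for some y in K. Taking norms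
    and traces down to F, these are conditions (2) and (3), since
    D_k(y + y', y y') = y^k + y'^k. Conversely each of the conditions gives an
    explicit factor: X^2 - t X + n divides X^(2p) - D_p(t,n) X^p + n^p, and
    X^8 + 4 D_4(t,n) X^4 + 16 n^4 is a norm of Sophie Germain's
    X^4 + 4 y^4 = (X^2 + 2 y X + 2 y^2) (X^2 - 2 y X + 2 y^2). *)

Require Import Defs.
From mathcomp Require Import all_boot all_order all_algebra.
From mathcomp Require Import all_field ring.
From Stdlib Require Import Classical.

Import GRing.Theory.
Local Open Scope ring_scope.

(** * Adjoining a root, and Capelli's lemma on compositions *)

Lemma irreducible_root_dvdp (K L : fieldType) (iota : {rmorphism K -> L})
    (p q : {poly K}) (z : L) :
  irreducible_poly p -> root (map_poly iota p) z ->
  root (map_poly iota q) z -> p %| q.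
Proof.
move=> irr_p pz qz; apply/negPn/negP; rewrite -irreducible_poly_coprime //.
rewrite -(coprimep_map iota) => /coprimep_root/(_ pz).
by move: qz; rewrite rootE => /eqP->; rewrite eqxx.
Qed.

Lemma irreducible_adjunction (K : fieldType) (p : {poly K}) :
  irreducible_poly p ->
  exists (L : fieldType) (iota : {rmorphism K -> L}) (z : L),
    root (map_poly iota p) z /\
    forall y, exists g : {poly K}, y = (map_poly iota g).[z].
Proof.
move=> /irredp_FAdjoin[L _ [z pz genz]]; exists L, (GRing.in_alg L), z.
split=> // y.
have: y \in <<1; z>>%VS by rewrite genz memvf.
case/Fadjoin_polyP => q /polyOver1P[g ->] ->; by exists g.
Qed.

Lemma modp_eq_horner (K L : fieldType) (iota : {rmorphism K -> L})
    (p g : {poly K}) (z : L) :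
  root (map_poly iota p) z ->
  (map_poly iota (g %% p)).[z] = (map_poly iota g).[z].
Proof.
move=> /rootP pz; rewrite [in RHS](divp_eq g p) rmorphD rmorphM /=.
by rewrite hornerD hornerM pz mulr0 add0r.
Qed.

(** This is the [g]-adic expansion of [q], regrouped by powers of X: [A j] collects the coefficients
    of X^j in all the digits. Dividing by [g] lowers the degree; passing from the quotient back to
    [q] multiplies each [A j] by X and adds a coefficient of the remainder. *)
Lemma comp_poly_expansion (K : fieldType) (g q : {poly K}) : (1 < size g)%N ->
  exists A : nat -> {poly K},
    q = \sum_(j < (size g).-1) (A j \Po g) * 'X^j.
Proof.
move=> g_gt1; have [n] := ubnP (size q); elim: n q => // n IHn q.
have [-> _|q_neq0 lt_qn] := eqVneq q 0.
  by exists (fun=> 0); rewrite big1 // => j _; rewrite comp_poly0 mul0r.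
have g_neq0 : g != 0 by rewrite -size_poly_gt0 ltnW.
have [|B defB] := IHn (q %/ g).
  rewrite size_divp //; apply: leq_trans (_ : size q <= n)%N => //.
  by rewrite ltn_subrL -subn1 subn_gt0 g_gt1 size_poly_gt0.
exists (fun j => B j * 'X + ((q %% g)`_j)%:P).
rewrite {1}(divp_eq q g) {1}defB mulr_suml.
have modE : q %% g = \sum_(j < (size g).-1) ((q %% g)`_j)%:P * 'X^j.
  rewrite -[LHS]coefK poly_def.
  rewrite (big_ord_widen (size g).-1 (fun j => (q %% g)`_j *: 'X^j)); last first.
    by rewrite -ltnS (ltn_predK g_gt1) ltn_modp.
  rewrite big_mkcond; apply: eq_bigr => j _; rewrite mul_polyC.
  by case: ltnP => // /(nth_default 0)->; rewrite scale0r.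
rewrite {1}modE -big_split; apply: eq_bigr => j _ /=.
by rewrite comp_poly_MXaddC mulrDl mulrAC.
Qed.

Lemma dvdp_comp_subC (K : fieldType) (p g : {poly K}) (z : K) :
  g - z%:P %| (p \Po g) - p.[z]%:P.
Proof.
have -> : g - z%:P = ('X - z%:P) \Po g.
  by rewrite comp_polyB comp_polyX comp_polyC.
rewrite -[p.[z]%:P](comp_polyC _ g) -comp_polyB dvdp_comp_poly //.
by rewrite dvdp_XsubCl rootE !hornerE subrr.
Qed.

(* Modulo [g - z], the expansion of [q] in powers of [g] becomes a polynomial
   of degree less than [deg g] whose coefficients are the [A j] at [z]; it must
   vanish, so the minimal polynomial [p] of [z] divides each [A j]. *)
Lemma comp_dvdp_of_subC (K L : fieldType) (iota : {rmorphism K -> L})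
    (p g q : {poly K}) (z : L) :
  irreducible_poly p -> root (map_poly iota p) z -> (1 < size g)%N ->
  map_poly iota g - z%:P %| map_poly iota q -> p \Po g %| q.
Proof.
move=> irr_p pz g_gt1 dvd_q; have [A defq] := comp_poly_expansion _ g q g_gt1.
pose r := \poly_(j < (size g).-1) (map_poly iota (A j)).[z].
have szgz : size (map_poly iota g - z%:P) = size g.
  rewrite size_polyDl ?size_map_poly //.
  by rewrite size_polyN size_polyC (leq_ltn_trans (leq_b1 _)).
have r0 : r = 0.
  apply/eqP; apply: contraTT dvd_q => r_neq0.
  suff dvd_qr: map_poly iota g - z%:P %| map_poly iota q - r.
    apply/negP => dvd_q; have := dvdp_sub dvd_q dvd_qr; rewrite subKr.
    move/(dvdp_leq r_neq0); rewrite szgz leqNgt.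
    by rewrite -[size g](ltn_predK g_gt1) ltnS size_poly.
  rewrite {1}defq rmorph_sum /r poly_def -sumrB.
  apply: (big_ind (fun u => _ %| u)); rewrite ?dvdp0 //.
    by move=> u v; apply: dvdp_add.
  move=> j _; rewrite rmorphM /= map_comp_poly map_polyXn -mul_polyC -mulrBl.
  by rewrite dvdp_mulr // dvdp_comp_subC.
rewrite defq; apply: (big_ind (fun u => _ %| u)); rewrite ?dvdp0 //.
  by move=> u v; apply: dvdp_add.
move=> j _; rewrite dvdp_mulr // dvdp_comp_poly //.
apply: irreducible_root_dvdp irr_p pz _; rewrite rootE.
by have /(congr1 (coefp j)) /= := r0; rewrite coef_poly ltn_ord coef0 => ->.
Qed.

(** Capelli's lemma. Over [L], the irreducible g - z divides p(g) = q r, hence q or r. By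
    [comp_dvdp_of_subC] all of p(g) then divides that same factor, so the other one is constant. *)
Lemma irreducible_comp (K L : fieldType) (iota : {rmorphism K -> L})
    (p g : {poly K}) (z : L) :
  irreducible_poly p -> root (map_poly iota p) z -> (1 < size g)%N ->
  irreducible_poly (map_poly iota g - z%:P) -> irreducible_poly (p \Po g).
Proof.
move=> irr_p pz g_gt1 irr_gz; have [p_gt1 _] := irr_p.
have pg_gt1 : (1 < size (p \Po g))%N.
  rewrite -subn_gt0 subn1 size_comp_poly muln_gt0 -!subn1 !subn_gt0.
  by rewrite p_gt1.
split=> // q q_neq1 q_dvd.
have [|ndvd] := boolP (map_poly iota g - z%:P %| map_poly iota q).
  move/(comp_dvdp_of_subC _ _ _ _ _ _ _ irr_p pz g_gt1) => dvd.
  by rewrite /eqp q_dvd.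
have pg_neq0 : p \Po g != 0 by rewrite -size_poly_gt0 ltnW.
move: ((p \Po g) %/ q) (divpK q_dvd) => r defpg.
have : map_poly iota g - z%:P %| map_poly iota (p \Po g).
  rewrite map_comp_poly.
  have := dvdp_comp_subC _ (map_poly iota p) (map_poly iota g) z.
  by rewrite (rootP pz) subr0.
rewrite -defpg rmorphM /= Gauss_dvdpl ?irreducible_poly_coprime //.
move/(comp_dvdp_of_subC _ _ _ _ _ _ _ irr_p pz g_gt1); rewrite -defpg.
have r_neq0 : r != 0 by apply: contraNneq pg_neq0 => r0; rewrite -defpg r0 mul0r.
rewrite -[X in _ %| X]mulr1 dvdp_mul2l // dvdp1 => szq.
by rewrite szq in q_neq1.
Qed.

(** * Norms and the Vahlen-Capelli criterion *)

(* [N] is the norm from [K[X]/(q)] to [K], built as a determinant. *)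
Lemma norm_mod_poly (K : fieldType) (q : {poly K}) :
  q \is monic -> (1 < size q)%N ->
  exists N : {poly K} -> K,
    [/\ forall f g, N (f * g) = N f * N g,
        forall f g, q %| f - g -> N f = N g,
        forall a, N a%:P = a ^+ (size q).-1
      & q`_0 = (-1) ^+ (size q).-1 * N 'X].
Proof.
move=> monq q_gt1.
have [C] : exists C : 'M[K]_((size q).-1), char_poly C = q.
  by exists (companionmx q); rewrite companionmxK.
have : (0 < (size q).-1)%N by rewrite -subn1 subn_gt0.
case: (size q).-1 C => // d C _ charC.
exists (fun f => \det (horner_mx C f)); split.
- by move=> f g; rewrite rmorphM /= det_mulmx.
- move=> f g /divpK qfg; apply/eqP; rewrite -subr_eq0; apply/eqP.
  suff -> : horner_mx C f = horner_mx C g by rewrite subrr.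
  apply/eqP; rewrite -subr_eq0 -rmorphB /= -qfg rmorphM /= -{2}charC.
  by rewrite Cayley_Hamilton mulr0.
- by move=> a; rewrite horner_mx_C det_scalar.
- by rewrite horner_mx_X -char_poly_det charC.
Qed.

Lemma norm_exp (K : fieldType) (N : {poly K} -> K) (d : nat) :
  (forall f g, N (f * g) = N f * N g) -> (forall a, N a%:P = a ^+ d) ->
  forall f k, N (f ^+ k) = N f ^+ k.
Proof.
move=> NM NC f; elim=> [|k IHk]; last by rewrite !exprS NM IHk.
by rewrite !expr0 -[1]/(1%:P) NC expr1n.
Qed.

(** From a Bezout relation u d = v p + 1, a = a^(u d) / a^(v p) = (x^u / a^v)^p. *)
Lemma coprime_root_exp (K : fieldType) (a x : K) (p d : nat) :
  (0 < d)%N -> coprime d p -> x ^+ p = a ^+ d -> a != 0 ->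
  exists y, a = y ^+ p.
Proof.
move=> d_gt0 /eqP co xa a_neq0; case: (egcdnP p d_gt0) => u v Euv _.
rewrite co in Euv; exists (x ^+ u / a ^+ v).
rewrite expr_div_n -!exprM (mulnC u) exprM xa -exprM (mulnC d) Euv.
by rewrite exprD expr1 mulrC mulKf // expf_neq0.
Qed.

(** Modulo a factor of degree d with 0 < d < p, X^p = a; taking norms gives N(X)^p = a^d. As d is
    prime to p, [a] would be a p-th power. *)
Lemma irreducible_XpsubC (K : fieldType) (p : nat) (a : K) :
  prime p -> (forall y, a <> y ^+ p) -> irreducible_poly ('X^p - a%:P).
Proof.
move=> p_pr nroot; have p_gt0 := prime_gt0 p_pr.
split; first by rewrite size_XnsubC.
move=> q q_neq1 q_dvd.
have szP : size ('X^p - a%:P) = p.+1 by rewrite size_XnsubC.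
have P_neq0 : 'X^p - a%:P != 0 by rewrite -size_poly_gt0 szP.
have q_neq0 : q != 0 by apply: dvdpN0 q_dvd P_neq0.
rewrite -dvdp_size_eqp // szP; apply: contraT => szq.
pose q1 := (lead_coef q)^-1 *: q.
have lq : (lead_coef q)^-1 != 0 by rewrite invr_eq0 lead_coef_eq0.
have q1_mon : q1 \is monic by rewrite monicE lead_coefZ mulVf // lead_coef_eq0.
have szq1 : size q1 = size q by rewrite size_scale.
have q_gt1 : (1 < size q)%N by rewrite ltn_neqAle eq_sym q_neq1 size_poly_gt0.
have q_le : (size q < p.+1)%N by rewrite ltn_neqAle szq -szP dvdp_leq.
have [|N [NM Nmod NC _]] := norm_mod_poly _ q1 q1_mon; first by rewrite szq1.
have: N ('X^p) = N a%:P by apply: Nmod; rewrite dvdpZl.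
rewrite (norm_exp _ _ _ NM NC) NC szq1 => Nroot.
have d_gt0 : (0 < (size q).-1)%N by rewrite -subn1 subn_gt0.
have [||y /nroot//] := coprime_root_exp _ a _ p _ d_gt0 _ Nroot.
  by rewrite coprime_sym prime_coprime // gtnNdvd // -ltnS (ltn_predK q_gt1).
by apply/eqP => a0; apply: (nroot 0); rewrite a0 expr0n gtn_eqF.
Qed.

(** Apply the norm of K(z) over K to z = u y^k: the constant [u] has norm u^p, and (-1)^p N(z) = -
    a. The sign is left inside (- u)^p because it depends on the parity of [p]. *)
Lemma norm_radical (K L : fieldType) (iota : {rmorphism K -> L}) (p k : nat)
    (a u : K) (z y : L) :
  (0 < p)%N -> irreducible_poly ('X^p - a%:P) ->
  root (map_poly iota ('X^p - a%:P)) z ->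
  (forall y, exists g : {poly K}, y = (map_poly iota g).[z]) ->
  z = iota u * y ^+ k -> exists x, - a = (- u) ^+ p * x ^+ k.
Proof.
move=> p_gt0 irrP Pz gen; have [g ->] := gen y => zE.
have [||N [NM Nmod NC Nq]] := norm_mod_poly _ ('X^p - a%:P).
- exact: monicXnsubC.
- by rewrite size_XnsubC.
have : 'X^p - a%:P %| 'X - u%:P * g ^+ k.
  apply: irreducible_root_dvdp irrP Pz _.
  rewrite rootE rmorphB rmorphM rmorphXn /= map_polyX map_polyC /= !hornerE.
  by rewrite -zE subrr.
move/Nmod; rewrite NM (norm_exp _ _ _ NM NC) NC => NX; exists (N g).
move: Nq; rewrite NX size_XnsubC //= coefB coefXn coefC eqxx /= eq_sym gtn_eqF //.
by rewrite sub0r => ->; rewrite mulrA -exprMn mulN1r.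
Qed.

Lemma size2_poly (K : nzRingType) (r : {poly K}) :
  (size r <= 2)%N -> r = r`_1 *: 'X + (r`_0)%:P.
Proof.
move=> szr; apply/polyP => i; rewrite coefD coefZ coefX coefC.
case: i => [|[|i]] /=; rewrite ?mulr0 ?mulr1 ?add0r ?addr0 //.
by rewrite nth_default ?(leq_trans szr).
Qed.

Lemma quadratic_generation (K L : fieldType) (iota : {rmorphism K -> L})
    (P : {poly K}) (z : L) : size P = 3 -> root (map_poly iota P) z ->
  (forall y, exists g : {poly K}, y = (map_poly iota g).[z]) ->
  forall y, exists r s, y = iota s * z + iota r.
Proof.
move=> szP Pz gen y; have [g ->] := gen y; rewrite -(modp_eq_horner _ _ _ P) //.
exists (g %% P)`_0, (g %% P)`_1; rewrite {1}[g %% P]size2_poly.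
  by rewrite rmorphD /= map_polyZ map_polyC map_polyX !hornerE.
have : (size (g %% P)%R < size P)%N by rewrite ltn_modp -size_poly_gt0 szP.
by rewrite szP.
Qed.

(* Comparing coordinates in [z = e (s z + r)^2] where [z^2 = a]: [r^2 + s^2 a]
   vanishes and [2 r s = e], hence [a = 4 r^2 s^2 a = - 4 r^4]. *)
Lemma sqrt_radical2 (K L : fieldType) (iota : {rmorphism K -> L})
    (a e : K) (z y : L) :
  irreducible_poly ('X^2 - a%:P) -> root (map_poly iota ('X^2 - a%:P)) z ->
  (forall y, exists g : {poly K}, y = (map_poly iota g).[z]) ->
  e ^+ 2 = 1 -> z = iota e * y ^+ 2 -> exists x, a = - 4 * x ^+ 4.
Proof.
move=> irrP Pz gen e2 zE.
have szP : size ('X^2 - a%:P) = 3 by rewrite size_XnsubC.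
have [r [s yE]] := quadratic_generation _ _ _ _ _ szP Pz gen y.
have zz : z ^+ 2 = iota a.
  apply/eqP; rewrite -subr_eq0; move: Pz; rewrite rootE rmorphB /= map_polyXn.
  by rewrite map_polyC /= !hornerE.
have : root (map_poly iota ((e * (2 * r * s) - 1) *: 'X +
                            (e * (r ^+ 2 + s ^+ 2 * a))%:P)) z.
  rewrite rootE rmorphD /= map_polyZ map_polyC map_polyX /= !hornerE.
  rewrite !(rmorphD, rmorphB, rmorphM, rmorphXn, rmorph1, rmorph_nat) /= -zz.
  apply/eqP; transitivity (iota e * (iota s * z + iota r) ^+ 2 - z).
    by ring.
  by rewrite -yE -zE subrr.
move/(irreducible_root_dvdp _ _ _ _ _ _ irrP Pz); set w := (X in _ %| X) => dvd_w.
have w0 : w = 0.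
  apply/eqP; apply: contraTT dvd_w => w_neq0; apply/negP => dvd_w.
  have := dvdp_leq w_neq0 dvd_w; rewrite szP leqNgt => /negP[].
  rewrite /w (leq_ltn_trans (size_polyD _ _)) //.
  rewrite gtn_max (leq_ltn_trans (size_scale_leq _ _)) ?size_polyX //=.
  by rewrite size_polyC (leq_ltn_trans (leq_b1 _)).
have /(congr1 (coefp 1)) := w0; have /(congr1 (coefp 0)) := w0.
rewrite /w /= !coefD !coefZ !coefX !coefC /= mulr0 mulr1 add0r addr0.
move=> E0 E1; exists r.
have E0' : r ^+ 2 + s ^+ 2 * a = 0.
  apply: (mulfI (x := e)); last by rewrite E0 mulr0.
  by apply: contra_eq_neq e2 => ->; rewrite expr0n /= eq_sym oner_eq0.
have E1' : 2 * r * s = e.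
  have /eqP := E1; rewrite subr_eq0 => /eqP E1'.
  transitivity (e ^+ 2 * (2 * r * s)); first by rewrite e2 mul1r.
  by rewrite expr2 -mulrA E1' mulr1.
transitivity ((2 * r * s) ^+ 2 * a); first by rewrite E1' e2 mul1r.
transitivity (4 * r ^+ 2 * (r ^+ 2 + s ^+ 2 * a) - 4 * r ^+ 4); first by ring.
by rewrite E0'; ring.
Qed.

(* The inductive step adjoins a root [z] of [X^p - a]; the norm of [z] carries
   the hypotheses on [a] over to [z], except for squares of [z] when [p = 2]. *)
Lemma vahlen_capelli (K : fieldType) (m : nat) (a : K) : (0 < m)%N ->
  (forall p, prime p -> (p %| m)%N -> forall y, a <> y ^+ p) ->
  ((4 %| m)%N -> forall y, a <> - 4 * y ^+ 4) ->
  irreducible_poly ('X^m - a%:P).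
Proof.
elim/ltn_ind: m K a => m IHm K a m_gt0 nroot nroot4.
have [->|m_neq1] := eqVneq m 1%N; first by rewrite expr1; apply: irredp_XsubC.
have m_gt1 : (1 < m)%N by rewrite ltn_neqAle eq_sym m_neq1.
have p_pr : prime (pdiv m) by apply: pdiv_prime.
have := pdiv_dvd m; move: (pdiv m) p_pr => p p_pr p_dvd.
have p_gt0 := prime_gt0 p_pr.
have irrP := irreducible_XpsubC _ _ _ p_pr (nroot p p_pr p_dvd).
have [L [iota [z [Pz gen]]]] := irreducible_adjunction _ _ irrP.
have /dvdnP[k defm] := p_dvd; have k_gt0 : (0 < k)%N.
  by move: m_gt0; rewrite defm muln_gt0 => /andP[].
have -> : 'X^m - a%:P = ('X^p - a%:P) \Po 'X^k.
  by rewrite comp_polyB comp_polyC comp_Xn_poly -exprM defm.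
apply: (irreducible_comp _ _ _ _ _ _ irrP Pz); first by rewrite size_polyXn.
rewrite map_polyXn; apply: IHm => //.
- by rewrite defm ltn_Pmulr // prime_gt1.
- move=> l l_pr l_dvd y zE.
  have l_dvdm : (l %| m)%N by rewrite defm dvdn_mulr.
  have [p2|p_odd] := even_prime p_pr; last first.
    have [|x] := norm_radical _ _ iota p l a 1 z y p_gt0 irrP Pz gen.
      by rewrite rmorph1 mul1r.
    rewrite -signr_odd p_odd expr1 mulN1r => /oppr_inj; exact: nroot.
  (* For p = l = 2 the norm shows only that - a is a square; [sqrt_radical2] gives a = - 4 x^4
     instead, excluded since 4 then divides [m]. *)
  have [l2|l_odd] := even_prime l_pr.
    move: irrP Pz zE; rewrite p2 l2 => irrP Pz zE.
    have [||x] := sqrt_radical2 _ _ iota a 1 z y irrP Pz gen.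
    - by rewrite expr1n.
    - by rewrite rmorph1 mul1r.
    by apply: nroot4; rewrite defm p2 -[4%N]/(2 * 2)%N dvdn_mul // -l2.
  have [|x] := norm_radical _ _ iota p l a 1 z y p_gt0 irrP Pz gen.
    by rewrite rmorph1 mul1r.
  rewrite p2 sqrrN expr1n mul1r => ax; apply: (nroot l l_pr l_dvdm (- x)).
  by rewrite exprNn -signr_odd l_odd expr1 mulN1r -ax opprK.
move=> dvd4 y zE; have dvd4m : (4 %| m)%N by rewrite defm dvdn_mulr.
have [p2|p_odd] := even_prime p_pr.
  move: irrP Pz; rewrite p2 => irrP Pz.
  (* For p = 2, read - 4 y^4 as minus the square of 2 y^2. *)
  have [||x] := sqrt_radical2 _ _ iota a (-1) z (2 * y ^+ 2) irrP Pz gen.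
  - by rewrite sqrrN expr1n.
  - by rewrite rmorphN1 zE; ring.
  exact: nroot4.
have [|x] := norm_radical _ _ iota p 4 a (- 4) z y p_gt0 irrP Pz gen.
  by rewrite zE rmorphN rmorph_nat.
rewrite opprK -[p]odd_double_half p_odd => ax.
(* With p = 2 h + 1, - a = 4^p x^4 gives a = - 4 (2^h x)^4, since (2^h)^4 = 4^(2 h). *)
apply: (nroot4 dvd4m (2 ^+ p./2 * x)).
have -> : (2 ^+ p./2 * x) ^+ 4 = 4 ^+ p./2.*2 * x ^+ 4.
  rewrite exprMn -exprM mulnC exprM -mul2n exprM; congr (_ ^+ _ * _); ring.
by apply: oppr_inj; rewrite ax exprD expr1; ring.
Qed.

(** * Dickson polynomials: norms, traces and explicit factors *)

(** The power sums of x and y obey the Dickson recursion with t = x + y and n = x y, and they start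
    with 2 and x + y. *)
Lemma dickson_add_mul (R : comNzRingType) (k : nat) (x y : R) :
  dickson k (x + y) (x * y) = x ^+ k + y ^+ k.
Proof.
elim/ltn_ind: k => -[|[|k]] IHk; rewrite ?expr1 //.
by rewrite dicksonSS !IHk // !exprS; ring.
Qed.

Lemma rmorph_dickson (R S : comNzRingType) (iota : {rmorphism R -> S})
    (k : nat) (t n : R) :
  iota (dickson k t n) = dickson k (iota t) (iota n).
Proof.
elim/ltn_ind: k => -[|[|k]] IHk //; first by rewrite /= rmorph_nat.
by rewrite !dicksonSS rmorphB !rmorphM !IHk.
Qed.

Lemma quadratic_coef_rmorph (F K : fieldType) (iota : {rmorphism F -> K})
    (b c : F) (z : K) :
  (map_poly iota ('X^2 + b *: 'X + c%:P)).[z] = z ^+ 2 + iota b * z + iota c.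
Proof.
by rewrite !rmorphD /= map_polyZ map_polyXn map_polyX map_polyC !hornerE.
Qed.

(* [n] and [t] are the norm and the trace of [y]: the conjugate [- b - z] of [z]
   is the same expression in the conjugate of [y]. *)
Lemma quadratic_norm_trace (F K : fieldType) (iota : {rmorphism F -> K})
    (b c u : F) (k : nat) (z y : K) (P := 'X^2 + b *: 'X + c%:P) :
  size P = 3 -> irreducible_poly P -> root (map_poly iota P) z ->
  (forall y, exists g : {poly F}, y = (map_poly iota g).[z]) ->
  z = iota u * y ^+ k ->
  exists n t, c = u ^+ 2 * n ^+ k /\ - b = u * dickson k t n.
Proof.
move=> szP irrP Pz gen zE.
have [r [s yE]] := quadratic_generation _ _ _ _ _ szP Pz gen y.
pose z' := - iota b - z; pose y' := iota s * z' + iota r.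
have Pz0 : z ^+ 2 + iota b * z + iota c = 0.
  by rewrite -quadratic_coef_rmorph; apply/rootP.
have Pz' : root (map_poly iota P) z'.
  by rewrite rootE quadratic_coef_rmorph -Pz0 /z'; apply/eqP; ring.
have zE' : z' = iota u * y' ^+ k.
  (* The relation z = u (s z + r)^k becomes a divisibility by [P] over [F], so it holds at the other
     root z' too. *)
  have : P %| 'X - u%:P * (s *: 'X + r%:P) ^+ k.
    apply: irreducible_root_dvdp irrP Pz _.
    rewrite rootE rmorphB rmorphM rmorphXn rmorphD /=.
    rewrite map_polyZ map_polyX !map_polyC /= !hornerE.
    by rewrite -yE -zE subrr.
  rewrite -(dvdp_map iota) => /dvdpP[w] /(congr1 (horner^~ z')).
  rewrite hornerM (rootP Pz') mulr0 rmorphB rmorphM rmorphXn.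
  rewrite rmorphD /= map_polyZ map_polyX !map_polyC /= !hornerE.
  by move/eqP; rewrite subr_eq0 => /eqP.
have cE : iota c = z * z'.
  by apply/eqP; rewrite -subr_eq0 -Pz0 /z'; apply/eqP; ring.
have bE : - iota b = z + z' by rewrite /z'; ring.
pose n := r ^+ 2 - b * r * s + c * s ^+ 2; pose t := 2 * r - b * s.
have nE : iota n = y * y'.
  rewrite /n !(rmorphD, rmorphN, rmorphM, rmorphXn) /= yE /y' cE.
  by rewrite -[iota b]opprK bE; ring.
have tE : iota t = y + y'.
  rewrite /t !(rmorphB, rmorphM) rmorph_nat yE /y' -[iota b]opprK bE; ring.
exists n, t; split; apply: (fmorph_inj iota).
  by rewrite rmorphM !rmorphXn /= nE cE zE zE' exprMn; ring.
rewrite rmorphN rmorphM /= rmorph_dickson tE nE dickson_add_mul mulrDr.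
by rewrite -zE -zE'.
Qed.

(** Together with [exp_congr], this allows n to be replaced by X (t - X) modulo q = X^2 - t X +
    n. *)
Lemma dickson_congr (R : comNzRingType) (k : nat) (t n q : R) :
  exists e, dickson k t (n - q) = dickson k t n + q * e.
Proof.
elim/ltn_ind: k => -[|[|k]] IHk.
- by exists 0; rewrite mulr0 addr0.
- by exists 0; rewrite mulr0 addr0.
have [e1 E1] := IHk k.+1 (ltnSn _); have [e0 E0] := IHk k (leqW (ltnSn _)).
exists (t * e1 - n * e0 + dickson k t n + q * e0).
by rewrite !dicksonSS E1 E0; ring.
Qed.

Lemma exp_congr (R : comNzRingType) (k : nat) (n q : R) :
  exists e, (n - q) ^+ k = n ^+ k + q * e.
Proof.
elim: k => [|k [e E]]; first by exists 0; rewrite mulr0 addr0.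
by exists (n * e - n ^+ k - q * e); rewrite !exprS E; ring.
Qed.

(** Modulo the quadratic, n = X (t - X), so D_k(t,n) = X^k + (t - X)^k and n^k = X^k (t - X)^k. Thus
    Y^2 - D_k(t,n) Y + n^k has the root Y = X^k. *)
Lemma quadratic_dvdp_dickson (F : fieldType) (k : nat) (t n : F) :
  'X^2 - t *: 'X + n%:P %| 'X^(2 * k) - dickson k t n *: 'X^k + (n ^+ k)%:P.
Proof.
set q := 'X^2 - _ + _.
have [e Ee] := dickson_congr _ k t%:P n%:P q.
have [e' Ee'] := exp_congr _ k n%:P q.
have nq : n%:P - q = 'X * (t%:P - 'X) by rewrite /q -mul_polyC; ring.
have DE : t%:P = 'X + (t%:P - 'X) by ring.
have := dickson_add_mul _ k 'X (t%:P - 'X); rewrite -DE -nq Ee => {}Ee.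
move: Ee'; rewrite nq exprMn => Ee'.
apply/dvdpP; exists ('X^k * e - e').
rewrite -mul_polyC (rmorph_dickson _ _ (polyC : {rmorphism F -> {poly F}})) /=.
rewrite rmorphXn /= mulnC exprM.
have -> : dickson k t%:P n%:P = 'X^k + (t%:P - 'X) ^+ k - q * e.
  by rewrite -Ee; ring.
have -> : n%:P ^+ k = 'X^k * (t%:P - 'X) ^+ k - q * e' by rewrite Ee'; ring.
by ring.
Qed.

(** * Degrees, and the proof of the equivalence *)

Lemma size_quadratic (F : fieldType) (b c : F) :
  size ('X^2 + b *: 'X + c%:P) = 3.
Proof.
rewrite -addrA size_polyDl size_polyXn // ltnS.
rewrite (leq_trans (size_polyD _ _)) // geq_max size_polyC.
by rewrite (leq_trans (size_scale_leq _ _)) ?size_polyX // (leq_trans (leq_b1 _)).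
Qed.

Lemma size_polyD_lt (F : fieldType) (p q : {poly F}) (n : nat) :
  (size p < n)%N -> (size q < n)%N -> (size (p + q)%R < n)%N.
Proof.
by move=> p_lt q_lt; rewrite (leq_ltn_trans (size_polyD _ _)) // gtn_max p_lt.
Qed.

Lemma trinomial_comp (F : fieldType) (m : nat) (b c : F) :
  'X^(2 * m) + b *: 'X^m + c%:P = ('X^2 + b *: 'X + c%:P) \Po 'X^m.
Proof.
rewrite !comp_polyD comp_polyZ comp_polyC comp_polyX comp_Xn_poly.
by rewrite -exprM mulnC.
Qed.

Lemma reducible_dvdp (F : fieldType) (q h : {poly F}) :
  q %| h -> (0 < (size q).-1 < (size h).-1)%N -> reducible_poly h.
Proof.
move=> q_dvd /andP[q_gt0 q_lt] [_ irr_h]; have /eqp_size szq : q %= h.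
  by apply: irr_h q_dvd; apply: contraTneq q_gt0 => ->.
by rewrite szq ltnn in q_lt.
Qed.

Theorem theorem1p1 (F : fieldType) (m : nat) (hm : (1 < m)%N) (b c : F) :
  reducible_poly ('X^(2 * m) + b *: 'X^m + c%:P) <->
  [\/ reducible_poly ('X^2 + b *: 'X + c%:P),
      exists p : nat, [/\ prime p, (p %| m)%N &
        exists n t : F, c = n ^+ p /\ b = - dickson p t n]
    | (4 %| m)%N /\
      exists n t : F, c = 16 * n ^+ 4 /\ b = 4 * dickson 4 t n].
Proof.
have m_gt0 : (0 < m)%N by apply: ltnW.
have szh : (size ('X^(2 * m) + b *: 'X^m + c%:P)%R).-1 = (2 * m)%N.
  by rewrite trinomial_comp size_comp_poly size_quadratic size_polyXn.
split=> [red_h|]; last first.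
  case=> [red_f|[p [p_pr /dvdnP[k defm] [n [t [cE bE]]]]]
               |[/dvdnP[k defm] [n [t [cE bE]]]]].
  (* A nonconstant divisor q of f gives the divisor q(X^m) of h. If h is irreducible they are
     associates, and comparing degrees shows that q has degree 2. *)
  - move=> [_ irr_h]; apply: red_f; split=> [|q q_neq1 q_dvd].
      by rewrite size_quadratic.
    have qh : q \Po 'X^m %= 'X^(2 * m) + b *: 'X^m + c%:P.
      rewrite trinomial_comp in irr_h *; apply: irr_h; last exact: dvdp_comp_poly.
      apply: contra q_neq1 => /eqP szq.
      have := size_comp_poly q 'X^m; rewrite szq size_polyXn /=.
      have: q != 0 by apply: dvdpN0 q_dvd _; rewrite -size_poly_gt0 size_quadratic.
      rewrite -size_poly_gt0; case: (size q) => [|[|d]] //= _ /esym/eqP.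
      by rewrite muln_eq0 /= gtn_eqF.
    have := eqp_size qh; rewrite -dvdp_size_eqp // size_quadratic.
    move/(congr1 predn); rewrite szh size_comp_poly size_polyXn /=.
    by move/eqP; rewrite eqn_pmul2r // => /eqP; case: (size q) => //= d ->.
  - have k_gt0 : (0 < k)%N by move: m_gt0; rewrite defm muln_gt0 => /andP[].
    apply: (reducible_dvdp _ (('X^2 - t *: 'X + n%:P) \Po 'X^k)).
      have -> : 'X^(2 * m) + b *: 'X^m + c%:P =
          ('X^(2 * p) - dickson p t n *: 'X^p + (n ^+ p)%:P) \Po 'X^k.
        rewrite cE bE scaleNr !comp_polyD comp_polyC raddfN /= comp_polyZ.
        by rewrite !comp_Xn_poly -!exprM defm mulnCA (mulnC k).
      exact/dvdp_comp_poly/quadratic_dvdp_dickson.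
    rewrite szh size_comp_poly -scaleNr size_quadratic size_polyXn /=.
    by rewrite muln_gt0 /= k_gt0 ltn_pmul2l // defm ltn_Pmulr // prime_gt1.
  have k_gt0 : (0 < k)%N by move: m_gt0; rewrite defm muln_gt0 => /andP[].
  (* For e = 1 and e = - 1, this is the norm of the Sophie Germain factor: the product of X^2 + 2 e
     y X + 2 y^2 and its conjugate in y', with t = y + y' and n = y y'. *)
  pose q (e : F) : {poly F} :=
    'X^4 + (2 * e * t) *: 'X^3 + (2 * t ^+ 2) *: 'X^2 +
    (4 * n * e * t) *: 'X + (4 * n ^+ 2)%:P.
  have qq : 'X^(2 * 4) + b *: 'X^4 + c%:P = q 1 * q (-1).
    rewrite /q cE bE dickson4 -!mul_polyC.
    rewrite !(polyCD, polyCB, polyCM, polyCN, rmorphXn, rmorph_nat) /=.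
    rewrite ?rmorph1 ?rmorphN1; ring.
  apply: (reducible_dvdp _ (q 1 \Po 'X^k)).
    have -> : 'X^(2 * m) + b *: 'X^m + c%:P =
        ('X^(2 * 4) + b *: 'X^4 + c%:P) \Po 'X^k.
      rewrite !comp_polyD comp_polyC comp_polyZ !comp_Xn_poly.
      by rewrite -!exprM defm mulnCA (mulnC k).
    by rewrite qq comp_polyM dvdp_mulr.
  have szq : size (q 1) = 5.
    rewrite /q -!addrA size_polyDl size_polyXn //.
    do 3?apply: size_polyD_lt.
    1-3: by rewrite (leq_ltn_trans (size_scale_leq _ _)) ?size_polyXn ?size_polyX.
    by rewrite size_polyC (leq_ltn_trans (leq_b1 _)).
  rewrite szh size_comp_poly szq size_polyXn /= defm mulnCA.
  by rewrite muln_gt0 /= k_gt0 mulnC ltn_pmul2l.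
have [irr_f|red_f] := classic (irreducible_poly ('X^2 + b *: 'X + c%:P));
  last by constructor 1.
have [L [iota [z [Pz gen]]]] := irreducible_adjunction _ _ irr_f.
have norm_trace := quadratic_norm_trace _ _ iota b c _ _ z _
  (size_quadratic _ b c) irr_f Pz gen.
apply: NNPP => none; apply: red_h; rewrite trinomial_comp.
apply: (irreducible_comp _ _ _ _ _ _ irr_f Pz); first by rewrite size_polyXn.
rewrite map_polyXn; apply: vahlen_capelli => // [p p_pr p_dvd y zE|dvd4 y zE].
  have [|n [t [cE bE]]] := norm_trace 1 p y; first by rewrite rmorph1 mul1r.
  apply: none; constructor 2; exists p; split=> //; exists n, t.
  by rewrite cE -[b]opprK bE expr1n !mul1r.
(* The constant u = - 4 yields c = (- 4)^2 n^4 and - b = - 4 D_4(t,n). *)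
have [|n [t [cE bE]]] := norm_trace (- 4) 4%N y.
  by rewrite zE rmorphN rmorph_nat.
apply: none; constructor 3; split=> //; exists n, t.
split; first by rewrite cE; ring.
by rewrite -[b]opprK bE; ring.
Qed.
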